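(* For every uncountable regular cardinal $\kappa$ and every $n\in\omega$, there exists an $(n+1,\kappa)$-semiladder of cardinality $\kappa^{+n}$.
   Context: For a set $X$, let $\overline{X}^{\top}$ denote the join-semilattice with underlying set $X\sqcup\{\mathbf 1\}$ in which $x\vee y=\mathbf 1$ for all distinct $x,y$; for $k\in\omega$, $\overline{k}^{\top}$ is this with $X=\{0,\dots,k-1\}$. A join-semilattice $P$ is $\overline{k}^{\top}$-free if it has no join-subsemilattice isomorphic to $\overline{k}^{\top}$; equivalently, whenever $x,x_0,\dots,x_{k-1}\in P$ satisfy $x_i\vee x_j=x$ for all distinct $i,j<k$, then $x_i=x$ for some $i<k$. For $m\in\omega$ and an infinite cardinal $\kappa$, an $(m,\kappa)$-semiladder is a nonempty join-semilattice that is $\overline{(m+1)}^{\top}$-free and all of whose principal ideals $\{q: q\le p\}$ have cardinality $<\kappa$. *)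

(* Defs.v *)
From HB Require Import structures.
From mathcomp Require Import all_boot all_order.
From mathcomp Require Import boolp classical_sets functions cardinality wochoice.

Set Implicit Arguments.
Unset Strict Implicit.
Unset Printing Implicit Defensive.

Import Order.TTheory.

Local Open Scope order_scope.
Local Open Scope classical_set_scope.
Local Open Scope card_scope.

(* A cardinal is represented by an arbitrary type of that cardinality. *)

Definition card_lt T U (A : set T) (B : set U) : Prop := (A #<= B) /\ ~ (B #<= A).

(* [R] orders [K] like the initial ordinal of cardinality |K|. *)
Definition initial_order (K : Type) (R : rel K) : Prop :=
  well_order R /\
  forall x, card_lt [set y | R y x /\ y <> x] [set: K].

(* |K| is infinite and equal to its own cofinality. *)
Definition regular_card (K : Type) : Prop :=
  infinite_set [set: K] /\
  exists2 R : rel K, initial_order R &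
    forall A : set K, (forall x, exists2 a, A a & R x a) -> A #= [set: K].

Definition uncountable_card (K : Type) : Prop := ~ countable [set: K].

(* |B| is the least cardinal greater than |A|. *)
Definition is_succ_card (A B : Type) : Prop :=
  card_lt [set: A] [set: B] /\
  forall C : Type, card_lt [set: A] [set: C] -> [set: B] #<= [set: C].

(* |B| = |K|^{+n} *)
Fixpoint is_iter_succ_card (n : nat) (K B : Type) : Prop :=
  if n is n'.+1
  then exists2 C : Type, is_iter_succ_card n' K C & is_succ_card C B
  else [set: B] #= [set: K].

(* [flat_top X] is X with a top [None] added, in which any two distinct elements
   have join [None]. *)

Fact flat_display : Order.disp_t. Proof. exact: Order.Disp tt tt. Qed.

Section FlatTop.
Variable X : choiceType.

Definition flat_top : Type := option X.

HB.instance Definition _ := Choice.copy flat_top (option X).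

Definition flat_le (x y : flat_top) := (x == y) || (y == None).

Definition flat_join (x y : flat_top) : flat_top := if x == y then x else None.

Fact flat_le_refl : reflexive flat_le.
Proof. by move=> x; rewrite /flat_le eqxx. Qed.

Fact flat_le_anti : antisymmetric flat_le.
Proof. by move=> [x|] [y|] //= /andP[]; rewrite /flat_le /= !orbF => /eqP. Qed.

Fact flat_le_trans : transitive flat_le.
Proof.
move=> y x z /orP[/eqP-> //|/eqP->] /orP[/eqP<-|/eqP->];
  by rewrite /flat_le eqxx orbT.
Qed.

HB.instance Definition _ := Order.Le_isPOrder.Build flat_display
  flat_top flat_le_refl flat_le_anti flat_le_trans.

Fact flat_leUx (x y z : flat_top) :
  (flat_join x y <= z) = (x <= z) && (y <= z).
Proof.
rewrite /flat_join; have [->|xy] := eqVneq x y; first by rewrite andbb.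
rewrite /Order.le /= /flat_le; case: z => [z|] /=; last by rewrite !orbT.
rewrite !orbF; apply/esym/negbTE/negP => /andP[/eqP xz /eqP yz].
by rewrite xz yz eqxx in xy.
Qed.

HB.instance Definition _ :=
  Order.POrder_isJoinSemilattice.Build flat_display flat_top flat_leUx.

End FlatTop.

Section Semiladder.
Variables (d : Order.disp_t) (P : joinSemilatticeType d).

Definition join_subsemilattice (S : set P) : Prop :=
  forall x y, S x -> S y -> S (x `|` y)%O.

Definition isomorphic_to d' (Q : joinSemilatticeType d') (S : set P) : Prop :=
  exists2 f : Q -> P, set_bij [set: Q] S f & {morph f : x y / (x `|` y)%O}.

Definition flat_top_free (k : nat) : Prop :=
  ~ exists2 S : set P, join_subsemilattice S &
      isomorphic_to (flat_top 'I_k) S.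

Definition semiladder (m : nat) (K : Type) : Prop :=
  [/\ [set: P] !=set0,
      flat_top_free m.+1 &
      forall p : P, card_lt [set q : P | q <= p] [set: K]].

End Semiladder.

(* Main.v *)
(**
  Call a finitary closure operator c on X "small" if closures of nonempty finite
  sets have size < kappa; its finitely generated closed sets, ordered by
  inclusion, form a join-semilattice with ideals of size < kappa.  By induction
  on n, if |X| < kappa^{+n} then every small closure condition g on X can be
  strengthened to a c whose semilattice has no x and x_0, ..., x_n, all different
  from x, with x_i v x_j = x for i <> j.  For n = 0 take c s = X.  For n+1, write X as an
  increasing union of g-closed sets X_w, w < kappa^{+n}, each of size
  < kappa^{+n} (this needs kappa uncountable), with rank r x = min {w | x in X_w}.
  By recursion on w the induction hypothesis gives c_w on X_w, chosen so that a
  c_w-closed set contains a point of rank w and is c_v-closed on X_v for every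
  v < w that is the rank of one of its points; put c s = c_w s for w = max r(s).
  If two elements both have rank below that of x, a single c_v-closed set
  contains their union, so their join is not x.  Hence all but one of the
  x_i have the rank w of x, and freeness of c_w applies to these.
*)
Require Import Defs.
From HB Require Import structures.
From mathcomp Require Import all_boot all_order.
From mathcomp Require Import boolp classical_sets functions cardinality wochoice.

Set Implicit Arguments.
Unset Strict Implicit.
Unset Printing Implicit Defensive.

Local Open Scope classical_set_scope.
Local Open Scope card_scope.

(** * Well-founded recursion and well-orders *)

(** Recursion along [lt] with a choice at each stage. Since [P f t u] sees [f] only below [t], it
    can be tested on the part of [f] built so far, extended by the default [u0]. *)
Lemma wf_choice (T U : Type) (lt : T -> T -> Prop) (P : (T -> U) -> T -> U -> Prop) :
    inhabited U -> well_founded lt ->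
    (forall f g t u, (forall s, lt s t -> f s = g s) -> P f t u -> P g t u) ->
    (forall f t, (forall s, lt s t -> P f s (f s)) -> exists u, P f t u) ->
  exists f, forall t, P f t (f t).
Proof.
move=> [u0] wf Pext Pex.
pose extend t (rec : forall s, lt s t -> U) s :=
  if pselect (lt s t) is left h then rec s h else u0.
pose F t rec := if pselect (exists u, P (@extend t rec) t u) is left h
                then projT1 (cid h) else u0.
pose f := Fix wf (fun=> U) F.
have fE t : f t = F t (fun s _ => f s).
  rewrite /f Init.Wf.Fix_eq // => x g h gh; congr F.
  by apply: functional_extensionality_dep => y; apply: functional_extensionality_dep.
exists f => t; elim/(well_founded_ind wf): t => t IH; rewrite fE /F.
have ext s : lt s t -> extend t (fun s _ => f s) s = f s.
  by rewrite /extend; case: pselect.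
case: pselect => [h|]; first exact: Pext ext (projT2 (cid h)).
case; have [u Pu] := Pex f t IH; exists u; apply: Pext Pu => s /ext ->.
by [].
Qed.

Definition strict_well_order T (lt : T -> T -> Prop) :=
  [/\ well_founded lt, forall x y z, lt x y -> lt y z -> lt x z &
      forall x y, [\/ lt x y, x = y | lt y x]].

Lemma wf_min T (lt : T -> T -> Prop) (P : T -> Prop) :
  well_founded lt -> (exists x, P x) ->
  exists2 x, P x & forall y, P y -> ~ lt y x.
Proof.
move=> wf [x Px]; apply: contrapT => noP; elim/(well_founded_ind wf): x Px => x IH Px.
by apply: noP; exists x => // y Py /IH; apply.
Qed.

Lemma wf_irr T (lt : T -> T -> Prop) x : well_founded lt -> ~ lt x x.
Proof. by move=> wf; elim/(well_founded_ind wf): x => x IH xx; apply: (IH x xx xx). Qed.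

(** [well_order] gives each nonempty set a unique least element; reflexivity, antisymmetry, totality
    and transitivity come from sets of at most three elements. *)
Lemma strict_of_well_order T (R : rel T) : well_order R ->
  strict_well_order (fun x y => R x y /\ x <> y) /\
  forall x y, R x y \/ R y x /\ y <> x.
Proof.
move=> wR.
have min (P : T -> Prop) : (exists x, P x) ->
    exists2 z, P z & forall x, P x -> R z x.
  move=> [x Px]; have [] := wR [pred x | `[< P x >]]; first by exists x; apply/asboolP.
  by move=> z [[/asboolP Pz zmin] _]; exists z => // y Py; apply/zmin/asboolP.
have refl x : R x x.
  by have [|z -> h] := min (fun y => y = x); [exists x|apply: h].
have anti x y : R x y -> R y x -> x = y.
  move=> xy yx; have [] := wR [pred z | `[< z = x \/ z = y >]].
    by exists x; apply/asboolP; left.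
  move=> z [_ zu]; transitivity z; first (symmetry; apply: zu); last apply: zu.
    split; first by apply/asboolP; left.
    by move=> t /asboolP[->|->].
  split; first by apply/asboolP; right.
  by move=> t /asboolP[->|->].
have tot x y : R x y \/ R y x.
  have [|z [->|->] h] := min (fun z => z = x \/ z = y); first by exists x; left.
    by left; apply: h; right.
  by right; apply: h; left.
have trans x y z : R x y -> R y z -> R x z.
  move=> xy yz; have [|t tP h] := min (fun t => [\/ t = x, t = y | t = z]).
    by exists x; constructor.
  case: tP h => -> h.
  - by apply: h; constructor 3.
  - by rewrite (anti x y) //; apply: h; constructor 1.
  - by rewrite -(anti y z) //; apply: h; constructor 2.
split; last first.
  move=> x y; have [->|xy] := pselect (x = y); first by left.
  by case: (tot x y); [left|right; split=> // /esym].
split.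
- move=> x; apply: contrapT => nx.
  have [|z nz h] := min (fun x => ~ Acc (fun x y => R x y /\ x <> y) x); first by exists x.
  apply: nz; constructor => y [yz yNz]; apply: contrapT => /h zy.
  by apply: yNz; apply: anti.
- move=> x y z [xy xNy] [yz yNz]; split; first exact: trans yz.
  by move=> xz; rewrite -xz in yz; apply: xNy; apply: anti.
- move=> x y; have [->|xy] := pselect (x = y); first by constructor 2.
  case: (tot x y) => h; first by constructor 1; split.
  by constructor 3; split=> // /esym.
Qed.

Lemma exists_strict_well_order (T : Type) :
  exists lt : T -> T -> Prop, strict_well_order lt.
Proof.
have [R wR] := well_ordering_principle {classic T}.
by exists (fun x y => R x y /\ x <> y); have [] := strict_of_well_order wR.
Qed.

(** * Comparison of cardinals by injections *)

Lemma card_le_inj T U (A : set T) (B : set U) (f : T -> U) :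
  (forall x, A x -> B (f x)) ->
  (forall x y, A x -> A y -> f x = f y -> x = y) -> A #<= B.
Proof.
move=> fB finj; apply: (@card_le_trans _ _ _ (f @` A)); last first.
  by apply: subset_card_le => _ [x /fB ? <-].
have /card_eqPle[] // : A #= f @` A; rewrite card_eq_sym; apply: inj_card_eq.
by move=> x y /set_mem Ax /set_mem Ay; apply: finj.
Qed.

Lemma card_le_injP T U (A : set T) (B : set U) (u0 : U) : A #<= B ->
  exists f : T -> U, (forall x, A x -> B (f x)) /\
    (forall x y, A x -> A y -> f x = f y -> x = y).
Proof.
pose V := HB.pack_for pointedType U (gen_eqMixin U) (gen_choiceMixin U) (isPointed.Build U u0).
move=> /(@pcard_leP _ V)[f]; exists f; split=> [x Ax|x y Ax Ay].
  exact: (@funS _ _ _ _ f).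
by apply: inj; rewrite inE.
Qed.

Lemma card_le_nonempty T U (A : set T) (B : set U) :
  A #<= B -> A !=set0 -> B !=set0.
Proof.
move=> AB [x Ax]; apply: contrapT => B0.
have /(card_le_trans AB)/card_le0P A0 : B #<= @set0 T.
  by apply: (@card_le_inj _ _ _ _ (fun=> x)) => [y By|y z By]; case: B0; exists y.
by rewrite A0 in Ax.
Qed.

(** Send each [t] in [D] recursively to a point of [E] not taken by its predecessors; one is left,
    since the predecessors do not dominate [E]. *)
Lemma card_le_segments T U (lt : T -> T -> Prop) (D : set T) (E : set U) :
    well_founded lt ->
    (forall x y, D x -> D y -> [\/ lt x y, x = y | lt y x]) ->
    (forall t, D t -> ~ (E #<= [set x | D x /\ lt x t])) -> D #<= E.
Proof.
move=> wf tot Dseg.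
have [[u0 Eu0]|E0] := pselect (E !=set0); last first.
  have -> : D = set0; last exact: card_ge0.
  apply/seteqP; split=> // t /Dseg; case.
  have -> : E = set0 by apply/seteqP; split=> // u Eu; apply: E0; exists u.
  exact: card_ge0.
pose P (f : T -> U) t u := D t -> E u /\ forall x, D x -> lt x t -> f x <> u.
have [||||f fP] := @wf_choice T U lt P => //.
- by move=> f g t u fg Pu Dt; have [Eu h] := Pu Dt; split=> // x Dx xt; rewrite -fg //; apply: h.
- move=> f t _; have [Dt|] := pselect (D t); last by exists u0.
  apply: contrapT => no; apply: (Dseg t Dt).
  apply: (@card_le_trans _ _ _ (f @` [set x | D x /\ lt x t])); last exact: card_image_le.
  apply: subset_card_le => u Eu; apply: contrapT => nu; apply: no; exists u => _.
  by split=> // x Dx xt fx; apply: nu; exists x.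
apply: (@card_le_inj _ _ _ _ f) => [x Dx|x y Dx Dy fxy]; first by case: (fP x Dx).
by case: (tot x y Dx Dy) => // h; [case: (fP y Dy)|case: (fP x Dx)] => _ /(_ _ _ h);
  rewrite fxy => k; case: (k).
Qed.

Lemma card_le_total T U (A : set T) (B : set U) : A #<= B \/ B #<= A.
Proof.
have [lt [wf _ tot]] := exists_strict_well_order T.
have [|nBA] := pselect (B #<= A); [by right|left].
apply: card_le_segments wf _ _ => [x y _ _|t _ h]; first exact: tot.
by apply: nBA; apply: card_le_trans h _; apply: subset_card_le => x [].
Qed.

(** * Sets of size below a regular cardinal *)

Definition small (L : Type) T (A : set T) := card_lt A [set: L].

Lemma smallP L T (A : set T) : small L A <-> ~ ([set: L] #<= A).
Proof.
split=> [[]//|h]; split=> //.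
by case: (card_le_total A [set: L]).
Qed.

Lemma small_le L T U (A : set T) (B : set U) : A #<= B -> small L B -> small L A.
Proof.
move=> AB [_ sB]; apply/smallP => LA.
by apply: sB; apply: card_le_trans AB.
Qed.

Lemma small_sub L T (A B : set T) : small L B -> A `<=` B -> small L A.
Proof. by move=> sB /subset_card_le AB; apply: small_le AB sB. Qed.

Lemma small_image L T U (f : T -> U) (A : set T) : small L A -> small L (f @` A).
Proof. exact: small_le (card_image_le _ _). Qed.

(** Regularity is stated as closure of smallness under small unions, the form used in the later
    counts; the last clause is uncountability. *)
Definition regular_uncountable (L : Type) :=
  [/\ exists2 lt : L -> L -> Prop, strict_well_order lt &
        forall m, small L [set y | lt y m],
      forall I T (D : set I) (F : I -> set T),
        small L D -> (forall i, D i -> small L (F i)) -> small L (\bigcup_(i in D) F i) &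
      small L [set: nat]].

Section Regular.
Variable L : Type.
Hypothesis regL : regular_uncountable L.

Lemma small_countable T (A : set T) : countable A -> small L A.
Proof. by move=> cA; apply: small_le cA _; case: regL. Qed.

Lemma small_setU T (A B : set T) : small L A -> small L B -> small L (A `|` B).
Proof.
move=> sA sB; rewrite -bigcup2E; case: regL => _ h _; apply: h; first by case: regL.
by move=> [|[|i]] _ //=; apply: small_countable; apply: countable0.
Qed.

Lemma small_set1 T (x : T) : small L [set x].
Proof. exact/small_countable/countable1. Qed.

(** Lists of length [n.+1] form a union, over their heads, of copies of the lists of length [n]; the
    union over all lengths is small by uncountability. *)
Lemma small_seq (X : eqType) (A : set X) : small L A ->
  small L [set s : seq X | forall x, x \in s -> A x].
Proof.
move=> sA.
have sn (n : nat) : small L [set s : seq X | size s = n /\ forall x, x \in s -> A x].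
  elim: n => [|n IH].
    apply: (small_sub (small_set1 [::])) => s [/size0nil -> _] //.
  have [_ h _] := regL.
  apply: (small_sub (h _ _ A (fun x => cons x @` _) sA (fun x _ => small_image (cons x) IH))).
  move=> [|x s] [] //= [sn] sA'; exists x; first by apply: sA'; rewrite mem_head.
  by exists s => //; split=> // y ys; apply: sA'; rewrite in_cons ys orbT.
have [_ h sN] := regL.
by apply: (small_sub (h _ _ _ _ sN (fun n _ => sn n))) => s sP; exists (size s).
Qed.

(* The rank is refined lexicographically by an arbitrary well-order of [T]. *)
Lemma card_le_rank T (D : set T) (rho : T -> L) (lt : L -> L -> Prop) :
  strict_well_order lt ->
  (forall m, small L [set x | D x /\ ~ lt m (rho x)]) -> D #<= [set: L].
Proof.
move=> [wf tr tot] sm.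
have [ltT [wfT _ totT]] := exists_strict_well_order T.
pose lx x y := lt (rho x) (rho y) \/ rho x = rho y /\ ltT x y.
have wfx : well_founded lx.
  have acc m : forall x, rho x = m -> Acc lx x.
    elim/(well_founded_ind wf): m => m IHm x.
    elim/(well_founded_ind wfT): x => x IHx rx; constructor => y [].
      by rewrite rx => /IHm; apply.
    by move=> [yx ltyx]; apply: IHx; rewrite ?yx.
  by move=> x; apply: (acc (rho x)).
apply: (card_le_segments wfx) => [x y _ _|t Dt].
  rewrite /lx; case: (tot (rho x) (rho y)) => h.
  - by constructor 1; left.
  - by rewrite h; case: (totT x y) => h'; [constructor 1; right|constructor 2|constructor 3; right].
  - by constructor 3; left.
apply/smallP/(small_sub (sm (rho t))) => x [Dx xt]; split=> // tx.
case: xt => [xt|[e _]]; last by rewrite e in tx; apply: wf_irr tx.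
by apply: (@wf_irr _ lt (rho t)) => //; apply: tr tx xt.
Qed.

End Regular.

(** A small set is strictly bounded, since otherwise it is cofinal and of full size. If [f] embedded
    [K] into a small union of small sets, the bounds of the preimages would have a common strict
    bound [z], yet [z] lies in one of these preimages. *)
Lemma regular_uncountableP (K : Type) :
  uncountable_card K -> regular_card K -> regular_uncountable K.
Proof.
move=> uK [iK [R [wR Rseg] Rcof]].
have [] := strict_of_well_order wR.
set lt := (fun x y => R x y /\ x <> y) => -[wf tr tot] Rlt.
have bounded (A : set K) : small K A -> exists x, forall a, A a -> lt a x.
  move=> [_ nA]; apply: contrapT => noub; apply: nA.
  have /card_eqPle[] // : A #= [set: K].
  apply: Rcof => x; apply: contrapT => nx.
  apply: noub; exists x => a Aa; case: (Rlt x a) => // Rxa.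
  by case: nx; exists a.
split.
- exists lt => // m; exact: Rseg.
- move=> I T D F sD sF; apply/smallP => KF.
  have [x0 _] : [set: K] !=set0 by apply: infinite_setN0.
  have [t0 _] := card_le_nonempty KF (ex_intro _ x0 Logic.I).
  have [f [fF finj]] := card_le_injP t0 KF.
  have /choice[x xP] : forall i, exists x, D i -> forall y, F i (f y) -> lt y x.
    move=> i; have [Di|nDi] := pselect (D i); last by exists x0.
    have [|x xP] := bounded [set y | F i (f y)]; last by exists x.
    apply: small_le (sF i Di); apply: (@card_le_inj _ _ _ _ f) => // y z _ _.
    exact: finj.
  have [z zP] := bounded _ (small_image x sD).
  have [i Di Fi] := fF z Logic.I; apply: (@wf_irr _ lt z) => //.
  by apply: tr (xP i Di z Fi) _; apply: zP; exists i.
- by apply/smallP.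
Qed.

(** * Successor cardinals *)

Lemma cantor_lt T : ~ ([set: set T] #<= [set: T]).
Proof.
move=> h; have [x0 _] := card_le_nonempty h (ex_intro _ set0 Logic.I).
have [f [_ finj]] := card_le_injP x0 h.
pose D := [set x | exists2 A, f A = x & ~ A x].
have [Df|nDf] := pselect (D (f D)); last by apply: (nDf); exists D.
by have [A fA] := Df; have -> := finj A D Logic.I Logic.I fA.
Qed.

Lemma regular_successor (L : Type) : regular_uncountable L ->
  exists L' : Type, is_succ_card L L' /\ regular_uncountable L'.
Proof.
move=> regL; have [[lt ltwo ltsmall] smallU smallN] := regL.
have [ltT [wfT trT totT]] := exists_strict_well_order (set L).
(* Hartogs-style: [B] is an initial segment of the well-ordered power set of [L],
   and proper by Cantor's theorem if |B| <= |L|. *)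
pose B : set (set L) := [set t | [set x | ltT x t] #<= [set: L]].
have Bdown t x : B t -> ltT x t -> B x.
  move=> Bt xt; apply: card_le_trans Bt; apply: subset_card_le => y yx.
  exact: trT xt.
have BL : ~ (B #<= [set: L]).
  move=> BL; have [|t nBt tmin] := @wf_min _ ltT (fun t => ~ B t) wfT.
    apply: contrapT => allB; apply: (@cantor_lt L).
    apply: card_le_trans BL; apply: subset_card_le => t _.
    by apply: contrapT => nBt; apply: allB; exists t.
  apply: nBt; apply: card_le_trans BL; apply: subset_card_le => x xt.
  by apply: contrapT => /tmin.
pose L' := {t | B t}.
have L'B : B #<= [set: L'].
  have [x0|nB] := pselect (inhabited L'); last first.
    have -> : B = set0; last exact: card_ge0.
    by apply/seteqP; split=> // t Bt; apply: nB; exists; exists t.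
  have /choice[f fP] : forall t, exists x : L', B t -> sval x = t.
    move=> t; have [Bt|nBt] := pselect (B t); first by exists (exist _ t Bt).
    by case: x0 => x; exists x.
  by apply: (@card_le_inj _ _ _ _ f) => // s t Bs Bt /(congr1 sval); rewrite !fP.
have LL' : card_lt [set: L] [set: L'].
  apply/smallP => /(card_le_trans L'B); exact: BL.
pose ltL' (x y : L') := ltT (sval x) (sval y).
have wfL' : well_founded ltL'.
  have acc x : forall t : L', sval t = x -> Acc ltL' t.
    elim/(well_founded_ind wfT): x => x IH t tx; constructor => s.
    by rewrite /ltL' tx => /IH; apply.
  by move=> t; apply: acc.
have totL' x y : [\/ ltL' x y, x = y | ltL' y x].
  case: x y => [x Bx] [y By]; rewrite /ltL' /=.
  case: (totT x y) => h; [by constructor 1| |by constructor 3].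
  by constructor 2; apply: eq_exist.
have segL' t : [set x | ltL' x t] #<= [set: L].
  apply: card_le_trans (svalP t).
  by apply: (@card_le_inj _ _ _ _ sval) => // -[x Bx] [y By] _ _ /= xy; apply: eq_exist.
(* Minimality of [L']: its initial segments embed into [L], so none of them dominates [E]. *)
have minL' U (E : set U) : ~ (E #<= [set: L]) -> [set: L'] #<= E.
  move=> nEL; apply: (card_le_segments wfL') => [x y _ _|t _ h]; first exact: totL'.
  apply: nEL; apply: card_le_trans h _; apply: card_le_trans (segL' t).
  by apply: subset_card_le => x [].
have smallE T (A : set T) : small L' A <-> A #<= [set: L].
  split=> [sA|AL]; last exact: small_le AL LL'.
  by apply: contrapT => /minL'; case: sA.
exists L'; split; first by split=> // C [_ /minL'].
split.
- exists ltL' => [|m]; last exact/smallE.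
  by split=> // x y z; apply: trT.
- move=> I T D F /smallE DL FL; apply/smallE.
  have [l0 _] : [set: L] !=set0.
    by case: smallN => /card_le_nonempty h _; apply: h; exists 0.
  have [e [_ einj]] := card_le_injP l0 DL.
  have /choice[d dinj] : forall i, exists d : T -> L, D i ->
      forall x y, F i x -> F i y -> d x = d y -> x = y.
    move=> i; have [Di|nDi] := pselect (D i); last by exists (fun=> l0).
    by have /smallE/(card_le_injP l0)[d []] := FL i Di; exists d.
  have [wf tr tot] := ltwo.
  have trN x y z : ~ lt x y -> ~ lt y z -> ~ lt x z.
    move=> xy yz xz; case: (tot y x) => [yx|yx|//]; last by rewrite yx in yz.
    by apply: yz; apply: tr yx xz.
  have irr x : ~ lt x x by apply: wf_irr.
  have anti x y : lt x y -> ~ lt y x by move=> xy yx; apply: (irr x); apply: tr xy yx.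
  (* A point [x] of the union has two codes in [L], the index code [e i] and the code [d i x] inside
     [F i]; [rho x] is the larger one. The points of rank at most [m] lie in a small union of small
     sets, so [card_le_rank] applies. *)
  have /choice[rho rhoP] : forall x, exists m, (\bigcup_(i in D) F i) x ->
      exists i, [/\ D i, F i x, ~ lt m (e i) & ~ lt m (d i x)].
    move=> x; have [[i Di Fix]|] := pselect ((\bigcup_(i in D) F i) x); last by exists l0.
    case: (tot (e i) (d i x)) => h; [exists (d i x)|exists (e i)|exists (e i)];
      move=> _; exists i; split; rewrite ?h //; exact: anti.
  have sle m : small L [set y | ~ lt m y].
    apply: small_sub (small_setU regL (ltsmall m) (small_set1 regL m)) _ => y /=.
    by case: (tot m y) => // h; [right|left].
  apply: (card_le_rank (rho := rho) ltwo) => m.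
  apply: (@small_sub _ _ _ (\bigcup_(i in [set i | D i /\ ~ lt m (e i)])
                              [set x | F i x /\ ~ lt m (d i x)])).
    apply: smallU => [|i [Di _]].
      apply: small_le (sle m); apply: (@card_le_inj _ _ _ _ e) => [i []//|i j [Di _] [Dj _]].
      exact: einj.
    apply: small_le (sle m); apply: (@card_le_inj _ _ _ _ (d i)) => [x []//|x y [Fx _] [Fy _]].
    exact: dinj.
  move=> x [Fx xm]; have [i [Di Fix ei dx]] := rhoP x Fx.
  by exists i; split=> //; apply: trN xm _.
- by apply/smallE; case: smallN.
Qed.

(** * Finitary closure conditions *)

(** Finite sets are encoded as lists; the empty list is excluded because it has no largest rank. *)
Definition nonempty_in (X : eqType) (A : set X) (s : seq X) : Prop :=
  s <> [::] /\ forall x, x \in s -> A x.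

Inductive generated (X : eqType) (g : seq X -> set X) (B : set X) : X -> Prop :=
| generated_base x : B x -> generated g B x
| generated_step s x : s <> [::] -> (forall y, y \in s -> generated g B y) ->
    g s x -> generated g B x.

(** The small closure conditions: [g s] collects the points that a closed set containing [s] is
    required to contain. *)
Definition respects (K : Type) (X : eqType) (A : set X) (g : seq X -> set X) : Prop :=
  forall s, nonempty_in A s -> g s `<=` A /\ small K (g s).

Lemma nonempty_in_sub (X : eqType) (A B : set X) s :
  A `<=` B -> nonempty_in A s -> nonempty_in B s.
Proof. by move=> AB [s0 sA]; split=> // x /sA /AB. Qed.

Lemma nonempty_in_cat (X : eqType) (A : set X) s t :
  nonempty_in A s -> nonempty_in A t -> nonempty_in A (s ++ t).
Proof.
move=> [s0 sA] [_ tA]; split=> [|x]; first by case: s s0 {sA}.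
by rewrite mem_cat => /orP[/sA|/tA].
Qed.

Lemma generated_sub K (X : eqType) (A B : set X) g :
  respects K A g -> B `<=` A -> generated g B `<=` A.
Proof.
move=> gA BA x; elim=> {x} [x /BA//|s x s0 _ sA gx].
by have [/(_ x gx)] := gA s (conj s0 sA).
Qed.

Lemma generated_mono (X : eqType) (B C : set X) g :
  B `<=` C -> generated g B `<=` generated g C.
Proof.
move=> BC x; elim=> {x} [x /BC|s x s0 _ sC gx]; first exact: generated_base.
exact: generated_step gx.
Qed.

(** As [g] acts on finite lists, countably many stages reach the closure, and uncountability of [L]
    keeps their union small. *)
Lemma small_generated K L (X : eqType) (A B : set X) g :
    regular_uncountable L -> (forall Y (C : set Y), small K C -> small L C) ->
    respects K A g -> B `<=` A -> small L B ->
  small L (generated g B).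
Proof.
move=> regL KL gA BA sB; have [_ smallU smallN] := regL.
pose stage n := iter n (fun S => S `|` \bigcup_(s in nonempty_in S) g s) B.
have stageA n : stage n `<=` A.
  elim: n => // n IH x [/IH//|[s sS gx]].
  by have [/(_ x gx)] := gA s (nonempty_in_sub IH sS).
have smallS n : small L (stage n).
  elim: n => // n IH; apply: small_setU => //; apply: smallU => [|s sS].
    by apply: small_sub (small_seq regL IH) _ => s [].
  by apply: KL; have [] := gA s (nonempty_in_sub (stageA n) sS).
have stageS m n : m <= n -> stage m `<=` stage n.
  move=> /subnK <-; elim: (n - m) => // k IH x /IH sx; exact: or_introl.
apply: small_sub (smallU _ _ _ _ smallN (fun n _ => smallS n)) _.
move=> x; elim=> {x} [x Bx|s x s0 _ sS gx]; first by exists 0.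
have [n sn] : exists n, forall y, y \in s -> stage n y.
  elim: s {s0 gx} sS => [|y s IH] sS; first by exists 0.
  have [|n sn] := IH; first by move=> z zs; apply: sS; rewrite in_cons zs orbT.
  have [|m _ my] := sS y; first by rewrite mem_head.
  exists (maxn m n) => z; rewrite in_cons => /orP[/eqP ->|/sn].
    by apply: stageS my; rewrite leq_maxl.
  by apply: stageS; rewrite leq_maxr.
by exists n.+1 => //; right; exists s.
Qed.

(* The sets [c s] ordered by inclusion have joins [c (s ++ t)]; the last clause
   makes them flat-top-free. *)
Definition free_closure (K : Type) (X : eqType) (k : nat) (A : set X)
    (g c : seq X -> set X) : Prop :=
  [/\ forall s, nonempty_in A s ->
        [/\ forall x, x \in s -> c s x, c s `<=` A & small K (c s)],
      forall s t, nonempty_in A s -> nonempty_in (c s) t -> c t `<=` c s,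
      forall s t, nonempty_in A s -> nonempty_in (c s) t -> g t `<=` c s &
      forall (s : 'I_k -> seq X) s0,
        nonempty_in A s0 -> (forall i, nonempty_in A (s i)) ->
        (forall i j, i != j -> c (s i ++ s j) = c s0) ->
        exists i, c (s i) = c s0].

(** * The inductive step: closures assembled along ranks *)

Lemma exists_max_rank (X : eqType) (L : Type) (lt : L -> L -> Prop) (r : X -> L) :
  strict_well_order lt ->
  inhabited L -> exists m : seq X -> L, forall s, s <> [::] ->
    (exists2 x, x \in s & r x = m s) /\ forall x, x \in s -> ~ lt (m s) (r x).
Proof.
move=> [wf tr tot] [l0].
suff : forall s, exists w, s <> [::] ->
    (exists2 x, x \in s & r x = w) /\ forall x, x \in s -> ~ lt w (r x).
  by move=> /choice[m mP]; exists m.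
have irr x : ~ lt x x by apply: wf_irr.
case=> [|x s]; first by exists l0.
suff [y ys ymax] : exists2 y, y \in x :: s & forall z, z \in x :: s -> ~ lt (r y) (r z).
  by exists (r y) => _; split=> //; exists y.
elim: s => [|y s [z zs zmax]].
  exists x; first exact: mem_head.
  by move=> z; rewrite inE => /eqP ->; apply: irr.
have [zy|nzy] := pselect (lt (r z) (r y)).
  exists y => [|t]; first by rewrite !inE eqxx orbT.
  have [-> _|ty] := eqVneq t y; first exact: irr.
  rewrite !inE (negPf ty) /= => tP yt; apply: (zmax t); first by rewrite inE.
  exact: tr zy yt.
exists z => [|t]; first by move: zs; rewrite !inE => /orP[->|->]; rewrite ?orbT.
have [-> //|ty] := eqVneq t y.
by rewrite !inE (negPf ty) /= => tP; apply: zmax; rewrite inE.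
Qed.

Section Step.
Variables (K L : Type) (X : eqType) (k : nat).
Hypotheses (regK : regular_uncountable K) (regL : regular_uncountable L).
Hypothesis smallKL : forall Y (C : set Y), small K C -> small L C.
Hypothesis IH : forall (A : set X) g, small L A -> respects K A g ->
  exists c, free_closure K k.+1 A g c.

Lemma free_closure_step (A : set X) g : A #<= [set: L] -> respects K A g ->
  exists c, free_closure K k.+2 A g c.
Proof.
move=> AL gA.
have [[x0 Ax0]|A0] := pselect (A !=set0); last first.
  have nA s : ~ nonempty_in A s.
    by case: s => [[]//|x s [_ /(_ x (mem_head _ _))] Ax]; apply: A0; exists x.
  exists g; split=> [s /nA//|s t /nA//|s t /nA//|s s0 /nA//].
have [[lt ltwo ltsmall] _ _] := regL.
have [_ smallUK _] := regK.
have [wf tr tot] := ltwo.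
have irr x : ~ lt x x by apply: wf_irr.
have anti x y : lt x y -> ~ lt y x by move=> xy yx; apply: (irr x); apply: tr xy yx.
have trN x y z : ~ lt x y -> ~ lt y z -> ~ lt x z.
  move=> xy yz xz; case: (tot y x) => [yx|yx|//]; last by rewrite yx in yz.
  by apply: yz; apply: tr yx xz.
have ltN x y : ~ lt x y -> lt y x \/ y = x by case: (tot x y) => // h _; [right|left].
have [l0 _] : [set: L] !=set0 by apply: card_le_nonempty AL _; exists x0.
have [phi [_ phi_inj]] := card_le_injP l0 AL.
(* [phi] codes [A] in [L]. The points with code at most [w] generate [Xw w], the increasing
   [g]-closed pieces that exhaust [A]. *)
pose B w := [set x | A x /\ ~ lt w (phi x)].
pose Xw w : set X := generated g (B w).
have BA w : B w `<=` A by move=> x [].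
have XA w : Xw w `<=` A := generated_sub gA (BA w).
have smallX w : small L (Xw w).
  apply: small_generated gA (BA w) _ => //.
  apply: (@small_le _ _ _ _ ([set y | lt y w] `|` [set w])).
    apply: (@card_le_inj _ _ _ _ phi) => [x [_ /ltN[]]|x y [Ax _] [Ay _]]; [by left|by right|].
    exact: phi_inj.
  by apply: small_setU => //; apply: small_set1.
have Xmono v w : ~ lt w v -> Xw v `<=` Xw w.
  by move=> wv; apply: generated_mono => x [Ax vx]; split=> //; apply: trN vx.
have /choice[r rP] : forall x, exists w, A x -> Xw w x /\ forall v, Xw v x -> ~ lt v w.
  move=> x; have [Ax|] := pselect (A x); last by exists l0.
  have [|w] := @wf_min _ lt (fun w => Xw w x) wf; last by exists w.
  by exists (phi x); apply: generated_base.
have XP w x : A x -> Xw w x <-> ~ lt w (r x).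
  move=> Ax; have [rx rmin] := rP x Ax; split; first exact: rmin.
  by move=> /Xmono; apply.
(* [h w] is a fixed point of rank [w], when there is one; forcing it into closed sets will let them
   remember their rank. *)
have /choice[h hP] : forall w, exists y, (exists2 x, A x & r x = w) -> A y /\ r y = w.
  by move=> w; have [[x Ax rx]|] := pselect (exists2 x, A x & r x = w); [exists x|exists x0].
pose rest v (s : seq X) := [seq z <- s | `[< Xw v z >]].
(* The condition imposed on [c w]: contain [h w], obey [g], and for each lower rank [v] of a point
   of [s] contain the [c v]-closure of the part of [s] in [Xw v]. It depends on [c] only below [w],
   as the recursion requires. *)
pose gw (c : L -> seq X -> set X) w s := [set h w] `|` g s `|`
  \bigcup_(x in [set x | x \in s /\ lt (r x) w]) c (r x) (rest (r x) s).
have restP x s : nonempty_in A s -> x \in s -> nonempty_in (Xw (r x)) (rest (r x) s).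
  move=> [_ sA] xs; have Xx : Xw (r x) x by have [] := rP x (sA x xs).
  split=> [E|y]; last by rewrite mem_filter => /andP[/asboolP].
  have : x \in rest (r x) s by rewrite mem_filter xs andbT; apply/asboolP.
  by rewrite E.
pose P (c : L -> seq X -> set X) w b := (exists2 x, A x & r x = w) ->
  free_closure K k.+1 (Xw w) (gw c w) b.
have [||||c cP] := @wf_choice L (seq X -> set X) lt P => //.
- move=> c c' w b cc' Pb hw; suff <- : gw c w = gw c' w by apply: Pb.
  apply/funext => s; rewrite /gw; congr (_ `|` _).
  by apply: eq_bigcupr => x [_ /cc' ->].
- move=> c w cP; have [hw|] := pselect (exists2 x, A x & r x = w); last by exists g.
  have [|b bP] := IH (smallX w) (g := gw c w); last by exists b.
  have [Ah rh] := hP w hw.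
  move=> s sX; have sA := nonempty_in_sub (XA w) sX.
  have cX x : x \in s -> lt (r x) w ->
      c (r x) (rest (r x) s) `<=` Xw (r x) /\ small K (c (r x) (rest (r x) s)).
    move=> xs xw; have [|h1 _ _ _] := cP (r x) xw; first by exists x => //; apply: (sA.2).
    by have [] := h1 _ (restP x s sA xs).
  split.
    move=> y [[->|gy]|[x [xs xw] cy]].
    - by apply/XP => //; rewrite rh.
    - by apply: generated_step gy; case: sX.
    - by apply: (Xmono (r x)); [apply: anti|apply: (cX x xs xw).1].
  apply: (small_setU regK); first apply: (small_setU regK).
  - exact: small_set1.
  - by have [] := gA s sA.
  - apply: smallUK => [|x [xs xw]]; last by have [] := cX x xs xw.
    apply: (small_countable regK); apply: sub_countable (finite_set_countable (finite_seq s)).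
    by apply: subset_card_le => x [].
have [m mP] := exists_max_rank r ltwo (inhabits l0).
have mA s : nonempty_in A s -> exists2 x, A x & r x = m s.
  by move=> [s0 sA]; have [[x xs rx] _] := mP s s0; exists x => //; apply: sA.
have mX s : nonempty_in A s -> nonempty_in (Xw (m s)) s.
  move=> [s0 sA]; split=> // x xs; apply/XP; first exact: sA.
  by have [_] := mP s s0; apply.
have eqm v w : ~ lt v w -> ~ lt w v -> v = w.
  by move=> vw wv; case: (tot v w).
have XmE w s : nonempty_in (Xw w) s -> ~ lt w (m s).
  move=> sX; have [x Ax rx] := mA s (nonempty_in_sub (XA w) sX).
  have [[y ys <-] _] := mP s sX.1.
  by have yX := sX.2 y ys; apply/XP => //; apply: XA yX.
have cm s : nonempty_in A s -> free_closure K k.+1 (Xw (m s)) (gw c (m s)) (c (m s)).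
  by move=> /mA; apply: cP.
have cX s : nonempty_in A s -> c (m s) s `<=` Xw (m s).
  by move=> sA; have [h1 _ _ _] := cm s sA; have [] := h1 s (mX s sA).
have gwE s t : nonempty_in A s -> nonempty_in (c (m s) s) t ->
    gw c (m s) t `<=` c (m s) s.
  by move=> sA ts; have [_ _ h3 _] := cm s sA; apply: h3 => //; apply: mX.
have cE s : nonempty_in A s -> nonempty_in (c (m s) s) s.
  by move=> sA; have [h1 _ _ _] := cm s sA; split; [case: sA|have [] := h1 s (mX s sA)].
have hm s : nonempty_in A s -> c (m s) s (h (m s)).
  by move=> sA; apply: (gwE s s sA (cE s sA)); left; left.
(* The point [h (m s)] has rank exactly [m s] and lies in the closure of [t], hence in
   [Xw (m t)]. *)
have m_le s t : nonempty_in A s -> nonempty_in A t ->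
    c (m s) s `<=` c (m t) t -> ~ lt (m t) (m s).
  move=> sA tA st; have /XP := cX t tA _ (st _ (hm s sA)).
  by have [Ah rh] := hP (m s) (mA s sA); rewrite rh; apply.
have m_eq s t : nonempty_in A s -> nonempty_in A t ->
    c (m s) s = c (m t) t -> m s = m t.
  by move=> sA tA E; apply: eqm; apply: m_le => //; rewrite E.
exists (fun s => c (m s) s); split.
- move=> s sA; have [h1 _ _ _] := cm s sA; have [xs _ sK] := h1 s (mX s sA).
  by split=> //; apply: subset_trans (cX s sA) (XA _).
- move=> s t sA ts.
  have tX := nonempty_in_sub (cX s sA) ts; have tA := nonempty_in_sub (XA _) tX.
  (* If [t] has lower rank than [s], then all of [t] lies in [Xw (m t)], so its closure is one of
     the sets that [gw] adds at rank [m s]. *)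
  have /ltN[ltm|->] := XmE _ _ tX; last first.
    by have [_ h2 _ _] := cm s sA; apply: h2 => //; apply: mX.
  apply: subset_trans (gwE s t sA ts) => y cy; right.
  have [[x xt rx] _] := mP t tA.1; exists x; rewrite /= rx //.
  suff -> : rest (m t) t = t by [].
  by apply/all_filterP/allP => z zt; apply/asboolP/(mX t tA).2.
- move=> s t sA ts; apply: subset_trans (gwE s t sA ts) => y gy.
  by left; right.
- move=> s s0 s0A sA sE; set w := m s0.
  (* The rank of a concatenation is attained in one of its two parts, and equal closures have equal
     ranks; so at most one [s i] misses rank [w]. *)
  have max i j : i != j -> m (s i) = w \/ m (s j) = w.
    move=> ij; have ijA := nonempty_in_cat (sA i) (sA j).
    rewrite /w -(m_eq _ _ ijA s0A (sE i j ij)).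
    have [[x xij rx] mmax] := mP (s i ++ s j) ijA.1.
    have half l : {subset s l <= s i ++ s j} -> x \in s l -> m (s l) = m (s i ++ s j).
      move=> lij xl; have [[y yl ry] lmax] := mP (s l) (sA l).1.
      by apply: eqm; [rewrite -rx; apply: lmax|rewrite -ry; apply/mmax/lij].
    move: (xij); rewrite mem_cat => /orP[xi|xj]; [left|right]; apply: half => // z zl;
      by rewrite mem_cat zl ?orbT.
  have [i0 i0P] : exists i0, forall i, i != i0 -> m (s i) = w.
    have [[i0 i0w]|] := pselect (exists i0, m (s i0) <> w).
      by exists i0 => i ii0; case: (max i i0 ii0).
    by move=> alleq; exists ord0 => i _; apply: contrapT => iw; apply: alleq; exists i.
  (* [lift i0] skips the exceptional index; the remaining [k.+1] lists all have rank [w], where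
     freeness of [c w] applies. *)
  have [_ _ _ /(_ (s \o lift i0) s0)] := cm s0 s0A.
  case=> [|j|i j ij|j /= jE].
  + exact: mX.
  + by rewrite /= -/w -(i0P (lift i0 j)) ?neq_lift 1?eq_sym ?neq_lift //; apply: mX.
  + have lij : lift i0 i != lift i0 j by rewrite (inj_eq lift_inj).
    have ijA := nonempty_in_cat (sA (lift i0 i)) (sA (lift i0 j)).
    by rewrite -[RHS](sE _ _ lij) (m_eq _ _ ijA s0A (sE _ _ lij)).
  + by exists (lift i0 j); rewrite i0P // eq_sym neq_lift.
Qed.
End Step.

(** * Induction along the iterated successors *)

Lemma small_succP A B T (C : set T) : is_succ_card A B ->
  small B C <-> C #<= [set: A].
Proof.
move=> [AB minB]; split=> [sC|CA]; last exact: small_le CA AB.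
apply: contrapT => nCA; case: sC => _; apply.
have /card_eqPle[CT TC] := card_setT C.
apply: card_le_trans CT; apply: minB; apply/smallP => h.
by apply: nCA; apply: card_le_trans h.
Qed.

Lemma is_iter_succ_card_eq n K B C :
  [set: C] #= [set: B] -> is_iter_succ_card n K B -> is_iter_succ_card n K C.
Proof.
move=> CB; have /card_eqPle[leCB leBC] := CB.
case: n => [|n] /=; first by move=> /(card_eq_trans CB).
move=> [D KD [[DB nBD] minB]]; exists D => //; split.
  split; first exact: card_le_trans leBC.
  by move=> CD; apply: nBD; apply: card_le_trans CD.
by move=> E /minB; apply: card_le_trans.
Qed.

(** Here [L] is the [n]-th successor of [K]. The set and the condition are arbitrary because the
    step applies the hypothesis to [Xw w] and [gw c w]. *)
Lemma exists_free_closure (K : Type) (n : nat) : regular_uncountable K ->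
  exists L, [/\ is_iter_succ_card n K L, regular_uncountable L,
    forall Y (C : set Y), small K C -> small L C &
    forall (X : eqType) (A : set X) g, small L A -> respects K A g ->
      exists c, free_closure K n.+1 A g c].
Proof.
move=> regK; elim: n => [|n [L [KL regL smallKL IH]]].
  exists K; split=> // [|X A g sA gA]; first exact: card_eqxx.
  (* For [n = 0] the set [A] itself has size below [K], so it can serve as the only closed set. *)
  exists (fun=> A); split.
  - by move=> s [_ sA']; split.
  - by move=> s t _ _ x.
  - by move=> s t _ /gA[].
  - by move=> s s0 _ _ _; exists ord0.
have [L' [LL' regL']] := regular_successor regL; exists L'; split=> //.
- by exists L.
- move=> Y C /smallKL[CL _]; exact/(small_succP _ LL').
- move=> X A g /(small_succP _ LL') AL gA.
  by apply: free_closure_step AL gA => // B f; apply: IH.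
Qed.

(** * The semilattice of finitely generated closed sets *)

Fact ladder_display : Order.disp_t. Proof. exact: Order.Disp tt tt. Qed.

Section Ladder.
Variables (X : eqType) (c : seq X -> set X).

Definition is_closure : Prop :=
  (forall s, s <> [::] -> forall x, x \in s -> c s x) /\
  (forall s t, s <> [::] -> nonempty_in (c s) t -> c t `<=` c s).

(** The closure laws are a parameter of the type so that order and join instances can be attached to
    it. *)
Definition ladder of is_closure : Type := {p : set X | exists2 s, s <> [::] & p = c s}.

Variable hc : is_closure.
Local Notation P := (ladder hc).

HB.instance Definition _ := gen_eqMixin P.
HB.instance Definition _ := gen_choiceMixin P.

Definition gens (p : P) : seq X := projT1 (cid2 (svalP p)).

Lemma gens_neq0 p : gens p <> [::].
Proof. by rewrite /gens; case: cid2. Qed.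

Lemma gensE p : sval p = c (gens p).
Proof. by rewrite /gens; case: cid2. Qed.

Definition ladder_of s (s0 : s <> [::]) : P :=
  exist (fun p => exists2 s, s <> [::] & p = c s) (c s) (ex_intro2 _ _ s s0 erefl).

Lemma ladder_eq (p q : P) : sval p = sval q -> p = q.
Proof. by case: p q => [p hp] [q hq] /= E; apply: eq_exist. Qed.

Lemma gens_inj : injective gens.
Proof. by move=> p q pq; apply: ladder_eq; rewrite !gensE pq. Qed.

Lemma cat_neq0 (s t : seq X) : s <> [::] -> s ++ t <> [::].
Proof. by case: s. Qed.

Definition ladder_le (p q : P) : bool := `[< sval p `<=` sval q >].

Definition ladder_join (p q : P) : P := ladder_of (cat_neq0 (t := gens q) (@gens_neq0 p)).

Fact ladder_le_refl : reflexive ladder_le.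
Proof. by move=> p; apply/asboolP. Qed.

Fact ladder_le_anti : antisymmetric ladder_le.
Proof.
move=> p q /andP[/asboolP pq /asboolP qp].
by apply: ladder_eq; apply/seteqP.
Qed.

Fact ladder_le_trans : transitive ladder_le.
Proof. by move=> q p r /asboolP pq /asboolP qr; apply/asboolP; apply: subset_trans qr. Qed.

HB.instance Definition _ := Order.Le_isPOrder.Build ladder_display
  P ladder_le_refl ladder_le_anti ladder_le_trans.

(** Inclusion is tested on generators. Both the join law and the count of principal ideals rest on
    this. *)
Lemma gens_sub (p q : P) : sval p `<=` sval q <-> nonempty_in (sval q) (gens p).
Proof.
have [cext cmono] := hc; split=> [pq|].
  split=> [|x xp]; first exact: gens_neq0.
  by apply: pq; rewrite gensE; apply: cext => //; apply: gens_neq0.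
by rewrite (gensE p) (gensE q); apply: cmono; apply: gens_neq0.
Qed.

Fact ladder_leUx (p q r : P) :
  (ladder_join p q <= r)%O = (p <= r)%O && (q <= r)%O.
Proof.
have [cext cmono] := hc.
have jE : sval (ladder_join p q) = c (gens p ++ gens q) by [].
have gen_join x : x \in gens p ++ gens q -> sval (ladder_join p q) x.
  by apply: cext; apply: cat_neq0; apply: gens_neq0.
apply/asboolP/andP => [jr|[/asboolP/gens_sub pr /asboolP/gens_sub qr]].
  by split; apply/asboolP/gens_sub; split=> [|x xs];
    [apply: gens_neq0|apply/jr/gen_join; rewrite mem_cat xs ?orbT
    |apply: gens_neq0|apply/jr/gen_join; rewrite mem_cat xs ?orbT].
rewrite jE (gensE r); apply: cmono; first exact: gens_neq0.
by apply: nonempty_in_cat; rewrite -gensE.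
Qed.

HB.instance Definition _ :=
  Order.POrder_isJoinSemilattice.Build ladder_display P ladder_leUx.

Lemma gens_join (p q : P) : sval (p `|` q)%O = c (gens p ++ gens q).
Proof. by []. Qed.

End Ladder.

(** A copy of the flat top would make freeness identify some [f (Some i)] with [f None], against
    injectivity. The ideal below [p] embeds by [gens] into the lists over the small set [sval p]. *)
Lemma ladder_semiladder (X : eqType) K m (c : seq X -> set X) (hc : is_closure c) :
    regular_uncountable K -> [set: X] !=set0 ->
    free_closure K m.+1 [set: X] (fun=> set0) c ->
  semiladder (ladder hc) m K.
Proof.
move=> regK [x0 _] [c1 _ _ cfree].
have adm p : nonempty_in [set: X] (@gens _ _ hc p) by split=> //; apply: gens_neq0.
split.
- have s0 : [:: x0] <> [::] by [].
  by exists (ladder_of hc s0).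
- move=> [S _ [f [_ finj _] fU]].
  have [|i|i j ij|i] := cfree (fun i => gens (f (Some i))) (gens (f None)).
  + exact: adm.
  + exact: adm.
  + rewrite -gens_join -fU -gensE; congr (sval (f _)).
    rewrite /Order.join /= /flat_join; case: eqVneq => // -[E].
    by rewrite E eqxx in ij.
  + rewrite -!gensE => /ladder_eq E.
    by have := finj _ _ (mem_set Logic.I) (mem_set Logic.I) E.
- move=> p; have [_ _ sK] := c1 _ (adm p).
  apply: small_le (small_seq regK (A := sval p) _); last by rewrite gensE.
  apply: (@card_le_inj _ _ _ _ (@gens _ _ hc)) => [q /asboolP/gens_sub[]//|].
  by move=> q r _ _; apply: gens_inj.
Qed.

(** * Cardinality of the semilattice, and the conclusion *)

(** Above, [gens] embeds the ladder into the lists over [L]. Below, the closed sets cover [L] and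
    are small, so fewer than |L| of them would make [L] small by regularity. *)
Lemma card_ladder L K m (c : seq {classic L} -> set {classic L}) (hc : is_closure c) :
    regular_uncountable L -> (forall Y (C : set Y), small K C -> small L C) ->
    free_closure K m.+1 setT (fun=> set0) c ->
  [set: ladder hc] #= [set: L].
Proof.
move=> regL smallKL [c1 _ _ _].
apply/card_eqPle; split.
  (* Being small for the successor [L'] means having size at most |L|, so [small_seq] for [L']
     bounds the number of lists by |L|. *)
  have [L' [LL' regL']] := regular_successor regL.
  apply: (@card_le_trans _ _ _ [set: seq {classic L}]).
    by apply: (@card_le_inj _ _ _ _ (@gens _ _ hc)) => // q r _ _; apply: gens_inj.
  apply/(small_succP _ LL'); apply: small_sub (small_seq regL' (A := [set: {classic L}]) _) _ => //.
  exact/(small_succP _ LL').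
have [//|PL] := card_le_total [set: L] [set: ladder hc].
apply: contrapT => nLP.
have [_ smallU _] := regL.
suff [_ []] : small L [set: L] by exact: card_lexx.
have sP : small L [set: ladder hc] by apply/smallP.
apply: small_sub (smallU _ _ _ sval sP _) _ => [p _|x _].
  apply: smallKL; rewrite gensE.
  by have [] := c1 _ (conj (@gens_neq0 _ _ hc p) (fun=> fun=> Logic.I)).
have s0 : [:: x : {classic L}] <> [::] by [].
by exists (ladder_of hc s0) => //; apply: hc.1; rewrite ?mem_head.
Qed.

Theorem theorem1p1 (K : Type) (hunc : uncountable_card K)
    (hreg : regular_card K) (n : nat) :
  exists (d : Order.disp_t) (P : joinSemilatticeType d),
    semiladder P n.+1 K /\ is_iter_succ_card n K P.
Proof.
have regK := regular_uncountableP hunc hreg.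
have [L [KL regL smallKL IH]] := exists_free_closure n regK.
(* The induction covers only sets of size below |L|. One more step, with the empty condition,
   reaches all of [L] and raises the index to [n.+2], as an [n.+1]-semiladder needs. *)
have [||c cfree] := @free_closure_step K L {classic L} n regK regL smallKL
    (fun A g => IH _ A g) setT (fun=> set0).
- exact: card_lexx.
- by move=> s _; split=> //; apply: small_countable => //; apply: countable0.
have hc : is_closure c.
  have [c1 c2 _ _] := cfree; split=> [s s0|s t s0 ts]; last by apply: c2.
  by have [] := c1 s (conj s0 (fun=> fun=> Logic.I)).
exists ladder_display, (ladder hc); split.
  apply: ladder_semiladder => //.
  by case: regL => _ _ [NL _]; apply: card_le_nonempty NL _; exists 0.
exact: is_iter_succ_card_eq (card_ladder hc regL smallKL cfree) KL.
Qed.
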